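(* Let $\mathcal K$ be a quantum channel on $n\times n$ matrices described by Kraus operators $K_1,\dots,K_d\in\mathbb C^{n\times n}$ (with $\mathcal K(\rho)=\sum_j K_j\rho K_j^\dagger$, $\sum_j K_j^\dagger K_j=I_n$) of the form $K_j=s_jP_j$, where $s_j\in\mathbb C$ and each $P_j=P_j^2=P_j^\dagger$ is an orthogonal projector of rank $r$ (the same $r$ for all $j$). Then $\lVert\mathcal K\rVert=\cos^{-1}\left(\sqrt{r/n}\right)$, with $\cos^{-1}$ taking values in $[0,\pi]$.
   Context: For a unitary matrix $U$ of size $m$ with eigenvalues $e^{i\theta_j}$, $\theta_j\in(-\pi,\pi]$, its time-energy cost is $\lVert U\rVert=\max_{1\le j\le m}|\theta_j|$. For a quantum channel $\mathcal K$ acting on an $n$-dimensional system $A$, its time-energy cost is $\lVert\mathcal K\rVert=\inf_U\lVert U\rVert$, where the infimum is over all finite-dimensional ancilla systems $B$ with a fixed standard state $|0\rangle_B$ and all unitaries $U_{BA}$ on $B\otimes A$ such that $\mathcal K(\rho)=\mathrm{Tr}_B[U_{BA}(|0\rangle_B\langle 0|\otimes\rho_A)U_{BA}^\dagger]$ for all density matrices $\rho$ on $A$. *)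

(* Defs.v *)
From HB Require Import structures.
From mathcomp Require Import all_boot all_order all_algebra.
From mathcomp Require Import complex mxtens.
From mathcomp Require Import all_classical all_reals all_analysis.
Set Implicit Arguments. Unset Strict Implicit. Unset Printing Implicit Defensive.
Import Order.TTheory GRing.Theory Num.Theory.
Local Open Scope ring_scope.
Local Open Scope classical_set_scope.
Local Open Scope complex_scope.

Section QDefs.
Variable R : realType.
Local Notation C := R[i].

Definition adj {m p : nat} (A : 'M[C]_(m, p)) : 'M[C]_(p, m) := (map_mx Num.conj A)^T.

Definition unitary {m : nat} (U : 'M[C]_m) : Prop := U *m adj U = 1%:M.

Definition expiC (t : R) : C := (cos t +i* sin t).

Definition ucost {m : nat} (U : 'M[C]_m) : R :=
  sup [set `|t| | t in [set t : R | (- pi < t) && (t <= pi) /\ eigenvalue U (expiC t)]].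

Definition density {n : nat} (rho : 'M[C]_n) : Prop :=
  (forall v : 'cV[C]_n, 0 <= (adj v *m rho *m v) 0 0) /\ \tr rho = 1.

Definition kraus_map {n d : nat} (K : 'I_d -> 'M[C]_n) (rho : 'M[C]_n) : 'M[C]_n :=
  \sum_(j < d) K j *m rho *m adj (K j).

Definition ptraceB {k n : nat} (X : 'M[C]_(k * n)) : 'M[C]_n :=
  \matrix_(a, a') \sum_(b < k) X (mxtens_index (b, a)) (mxtens_index (b, a')).

(* U on B (x) A (dim B = k.+1, standard state |0>) dilates the map Phi *)
Definition dilates {k n : nat} (Phi : 'M[C]_n -> 'M[C]_n) (U : 'M[C]_(k.+1 * n)) : Prop :=
  forall rho : 'M[C]_n, density rho ->
    Phi rho = ptraceB (U *m (tensmx (delta_mx (0 : 'I_k.+1) 0) rho) *m adj U).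

Definition ccost {n : nat} (Phi : 'M[C]_n -> 'M[C]_n) : R :=
  inf [set x : R | exists (k : nat) (U : 'M[C]_(k.+1 * n)),
        unitary U /\ dilates Phi U /\ x = ucost U].

End QDefs.

(* Main.v *)
Require Import Defs.
From HB Require Import structures.
From mathcomp Require Import all_boot all_order all_algebra.
From mathcomp Require Import complex mxtens.
From mathcomp Require Import all_classical all_reals all_analysis.
From mathcomp Require Import ring lra.
Set Implicit Arguments. Unset Strict Implicit. Unset Printing Implicit Defensive.
Import Order.TTheory GRing.Theory Num.Theory.
Local Open Scope ring_scope.

(** Lower bound: let F_b = <b|U|0> be the Kraus operators read off a dilation U.
    The trace of the superoperator is sum_b |tr F_b|^2 = sum_j |tr K_j|^2 = n r,
    so Re (tr F_0) <= sqrt (n r). On the other hand tr F_0 is the trace of the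
    compression of U to |0> (x) A, hence a combination of eigenvalues of U with
    nonnegative weights of total mass n, so Re (tr F_0) >= n cos ||U||.

    Upper bound: with c = sqrt (r/n), the operators c I and s_j (P_j - c^2 I) are
    Kraus operators of the same channel. Their isometry V = sum_b |b> (x) F_b
    satisfies <0|V = c I, so it extends to the rotation by acos c in the planes
    spanned by |0> (x) v and V v, whose eigenvalues are 1 and exp (+-i acos c). *)

(** * Adjoints and eigenvalues of unitary matrices *)

Section Adjoint.
Variable R : realType.
Local Notation C := R[i].

Lemma adjE (m n : nat) (A : 'M[C]_(m, n)) i j : adj A i j = (A j i)^*.
Proof. by rewrite !mxE. Qed.

Lemma adjK (m n : nat) (A : 'M[C]_(m, n)) : adj (adj A) = A.
Proof. by apply/matrixP=> i j; rewrite !adjE conjCK. Qed.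

Lemma adjM (m n p : nat) (A : 'M[C]_(m, n)) (B : 'M[C]_(n, p)) :
  adj (A *m B) = adj B *m adj A.
Proof. by rewrite /adj map_mxM trmx_mul. Qed.

Lemma adj_is_additive (m n : nat) : zmod_morphism (@adj R m n).
Proof. by move=> A B; apply/matrixP=> i j; rewrite !(adjE, mxE) rmorphB. Qed.

HB.instance Definition _ (m n : nat) :=
  GRing.isZmodMorphism.Build _ _ (@adj R m n) (@adj_is_additive m n).

Lemma adjZ (m n : nat) (a : C) (A : 'M[C]_(m, n)) : adj (a *: A) = a^* *: adj A.
Proof. by apply/matrixP=> i j; rewrite !(adjE, mxE) rmorphM. Qed.

Lemma adj_scalar (n : nat) (a : C) : adj (a%:M : 'M[C]_n) = a^*%:M.
Proof. by apply/matrixP=> i j; rewrite !(adjE, mxE) rmorphMn/= eq_sym. Qed.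

Lemma adj1 (n : nat) : adj (1%:M : 'M[C]_n) = 1%:M.
Proof. by rewrite adj_scalar rmorph1. Qed.

Lemma adj_delta (m n : nat) i j : adj (delta_mx i j : 'M[C]_(m, n)) = delta_mx j i.
Proof. by apply/matrixP=> a b; rewrite !(adjE, mxE) rmorph_nat andbC. Qed.

Lemma mulmx_adj_diag (m n : nat) (A : 'M[C]_(m, n)) i :
  (A *m adj A) i i = \sum_j `|A i j| ^+ 2.
Proof. by rewrite mxE; apply: eq_bigr => j _; rewrite adjE normCK. Qed.

Lemma adj_unitary (n : nat) (U : 'M[C]_n) : unitary U -> adj U *m U = 1%:M.
Proof. exact: mulmx1C. Qed.

Lemma adj_mulmx_eq0 (n : nat) (v : 'rV[C]_n) : v *m adj v = 0 -> v = 0.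
Proof.
move=> /matrixP/(_ 0 0); rewrite mulmx_adj_diag mxE => /eqP.
rewrite psumr_eq0 => [/allP v0|j _]; last by rewrite exprn_ge0.
apply/matrixP=> i j; rewrite ord1 mxE; apply/eqP.
by have := v0 j (mem_index_enum _); rewrite expf_eq0/= normr_eq0.
Qed.

Lemma unitary_eigenvalue_norm (n : nat) (U : 'M[C]_n) (a : C) :
  unitary U -> eigenvalue U a -> a * a^* = 1.
Proof.
move=> Uu /eigenvalueP[v vU v0].
have := congr1 (fun w => w *m adj w) vU.
rewrite /= adjM mulmxA -(mulmxA v) Uu mulmx1 adjZ -scalemxAl -scalemxAr scalerA.
move=> E; apply: contra_not_eq (elimN eqP v0) => a1; apply: adj_mulmx_eq0.
apply/eqP; move/eqP: E; rewrite -subr_eq0 -{1}[_ *m _]scale1r -scalerBl.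
by rewrite scaler_eq0 subr_eq0 eq_sym (negPf a1).
Qed.

(** Right multiplication by [adj U] undoes [U], and [a^*] is the inverse of [a], which has modulus
    1. *)
Lemma unitary_eigenvector_adj (n : nat) (U : 'M[C]_n) (a : C) (v : 'rV[C]_n) :
  unitary U -> v *m U = a *: v -> v != 0 -> v *m adj U = a^* *: v.
Proof.
move=> Uu vU v0; have aa : a * a^* = 1.
  by apply: (unitary_eigenvalue_norm Uu); apply/eigenvalueP; exists v.
rewrite -[v in LHS]scale1r -aa mulrC -scalerA -vU -scalemxAl -mulmxA Uu.
by rewrite mulmx1.
Qed.

End Adjoint.

(** * Rotation in planes joining two orthogonal ranges *)

Section Rotation.
Variables (R : realType) (N n : nat) (c : R[i]) (A W : 'M[R[i]]_(N, n)).
Hypotheses (creal : c^* = c) (c1 : 1 + c != 0).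
Hypotheses (AA : adj A *m A = 1%:M) (AW : adj A *m W = 0)
  (WW : adj W *m W = (1 - c ^+ 2)%:M).

(* Rotation by acos c in the planes spanned by A v and W v; the division by
   1 + c is what remains of normalising W, and it keeps c = 1 (W = 0) regular. *)
Definition plane_rotation : 'M[R[i]]_N :=
  1%:M + (c - 1) *: (A *m adj A) - (1 + c)^-1 *: (W *m adj W)
  + W *m adj A - A *m adj W.

Let WA : adj W *m A = 0.
Proof. by rewrite -[A]adjK -adjM AW raddf0. Qed.

Lemma adj_plane_rotation : adj plane_rotation =
  1%:M + (c - 1) *: (A *m adj A) - (1 + c)^-1 *: (W *m adj W)
  + A *m adj W - W *m adj A.
Proof.
rewrite /plane_rotation !(raddfB, raddfD) /= !adjZ !adjM !adjK adj1.
have c1K : (c - 1)^* = c - 1 by rewrite rmorphB/= rmorph1 creal.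
have c1V : ((1 + c)^-1)^* = (1 + c)^-1 by rewrite fmorphV/= rmorphD/= rmorph1 creal.
by rewrite c1K c1V.
Qed.

Lemma plane_rotation_first : plane_rotation *m A = c *: A + W.
Proof.
rewrite /plane_rotation !(mulNmx, mulmxDl) -!scalemxAl -!mulmxA AA WA.
rewrite !mulmx0 !mulmx1 mul1mx scaler0.
by apply/matrixP=> i j; rewrite !mxE; ring.
Qed.

Lemma plane_rotation_second :
  plane_rotation *m W = c *: W - (1 - c ^+ 2) *: A.
Proof.
rewrite /plane_rotation !(mulNmx, mulmxDl) -!scalemxAl -!mulmxA AW WW.
rewrite !mulmx0 mul1mx !mul_mx_scalar scaler0 !addr0 scalerA.
apply/matrixP=> i j; rewrite !mxE.
by field.
Qed.

(** Once the product is distributed over the terms of the adjoint, the rotation meets only [A] and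
    [W], whose images are known. *)
Lemma plane_rotation_unitary : unitary plane_rotation.
Proof.
rewrite /unitary adj_plane_rotation !(mulmxN, mulmxDr) -!scalemxAr !mulmxA.
rewrite plane_rotation_first plane_rotation_second mulmx1 /plane_rotation.
rewrite !(mulNmx, mulmxDl) -!scalemxAl.
set a := A *m adj A; set w := W *m adj W; set x := W *m adj A.
set y := A *m adj W.
clearbody a w x y.
apply/matrixP=> i j; rewrite !mxE.
by field.
Qed.

(* The Hermitian part of the rotation minus the identity. *)
Let H := (c - 1) *: (A *m adj A) - (1 + c)^-1 *: (W *m adj W).

Let HH : H *m H = (c - 1) *: H.
Proof.
rewrite /H mulmxBr !mulmxBl -!scalemxAl -!scalemxAr.
rewrite !mulmxA -(mulmxA A _ A) AA -(mulmxA W _ A) WA -(mulmxA A _ W) AW.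
rewrite -(mulmxA W _ W) WW mulmx1 !mulmx0 !mul0mx !mul_mx_scalar -!scalemxAl.
apply/matrixP=> i j; rewrite !mxE.
by field.
Qed.

(** An eigenvector for [a] is one of the adjoint for [a^*], hence one of [H] for ['Re a - 1]. The
    relation [H *m H = (c - 1) *: H] then leaves only 1 and [c] for ['Re a]. *)
Lemma plane_rotation_eigenvalue (a : R[i]) :
  eigenvalue plane_rotation a -> ('Re a - 1) * (c - 'Re a) = 0.
Proof.
case/eigenvalueP=> v vU v0.
have vUa := unitary_eigenvector_adj plane_rotation_unitary vU v0.
have vH : v *m H = ('Re a - 1) *: v.
  have -> : H = 2^-1 *: (plane_rotation + adj plane_rotation) - 1%:M.
    rewrite adj_plane_rotation /plane_rotation /H.
    by apply/matrixP=> i j; rewrite !mxE; field.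
  rewrite mulmxBr -scalemxAr mulmxDr vU vUa mulmx1 ReE -scalerDl scalerA.
  by rewrite scalerBl scale1r [_ * 2^-1]mulrC.
have := congr1 (mulmx^~ H) vH; rewrite -mulmxA HH -scalemxAr -scalemxAl vH.
move/eqP; rewrite -subr_eq0 !scalerA -scalerBl scaler_eq0 (negPf v0) orbF.
by move/eqP <-; ring.
Qed.

End Rotation.

(** * Block columns and their partial traces *)

Section BlockColumn.
Variables (R : realType) (k n : nat).
Local Notation C := R[i].

(* The operator sum_b |b> (x) F b from A to B (x) A. *)
Definition block_col (F : 'I_k -> 'M[C]_n) : 'M[C]_(k * n, n) :=
  \matrix_(i, j) F (mxtens_unindex i).1 (mxtens_unindex i).2 j.

Lemma sum_mxtens_index (f : 'I_(k * n) -> C) :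
  \sum_i f i = \sum_(b < k) \sum_(a < n) f (mxtens_index (b, a)).
Proof.
rewrite pair_big /= (reindex (@mxtens_index k n)) /=.
  by apply: eq_bigr => -[].
by exists (@mxtens_unindex k n) => i _; rewrite (mxtens_indexK, mxtens_unindexK).
Qed.

Lemma block_colE (F : 'I_k -> 'M[C]_n) b a j :
  block_col F (mxtens_index (b, a)) j = F b a j.
Proof. by rewrite mxE mxtens_indexK. Qed.

Lemma block_col_surj (M : 'M[C]_(k * n, n)) :
  M = block_col (fun b => \matrix_(a, j) M (mxtens_index (b, a)) j).
Proof.
by apply/matrixP=> i j; case: (mxtens_indexP i) => b a; rewrite block_colE mxE.
Qed.

Lemma block_col_mul (F : 'I_k -> 'M[C]_n) (X : 'M[C]_n) :
  block_col F *m X = block_col (fun b => F b *m X).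
Proof.
apply/matrixP=> i j; case: (mxtens_indexP i) => b a; rewrite block_colE !mxE.
by apply: eq_bigr => a' _; rewrite block_colE.
Qed.

Lemma block_col_mul_adj (F G : 'I_k -> 'M[C]_n) b a b' a' :
  (block_col F *m adj (block_col G)) (mxtens_index (b, a)) (mxtens_index (b', a'))
  = (F b *m adj (G b')) a a'.
Proof.
by rewrite !mxE; apply: eq_bigr => l _; rewrite !adjE !block_colE.
Qed.

Lemma adj_block_col_mul (F G : 'I_k -> 'M[C]_n) :
  adj (block_col F) *m block_col G = \sum_b adj (F b) *m G b.
Proof.
apply/matrixP=> i j; rewrite summxE mxE sum_mxtens_index.
apply: eq_bigr => b _; rewrite mxE; apply: eq_bigr => a _.
by rewrite !adjE !block_colE.
Qed.

Lemma ptraceB_block_col (F G : 'I_k -> 'M[C]_n) (X : 'M[C]_n) :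
  ptraceB (block_col F *m X *m adj (block_col G)) = \sum_b F b *m X *m adj (G b).
Proof.
apply/matrixP=> i j; rewrite mxE summxE; apply: eq_bigr => b _.
by rewrite block_col_mul block_col_mul_adj.
Qed.

End BlockColumn.

(** * Kraus operators read off a dilation *)

Section StandardState.
Variables (R : realType) (k n : nat).
Local Notation C := R[i].

(* The isometry v |-> |0> (x) v. *)
Definition ket0 : 'M[C]_(k.+1 * n, n) :=
  block_col (fun b => (b == 0)%:R%:M).

Lemma ket0_block_col (F : 'I_k.+1 -> 'M[C]_n) : adj ket0 *m block_col F = F 0.
Proof.
rewrite adj_block_col_mul (bigD1 0)//= big1 => [|b /negPf->].
  by rewrite adj1 mul1mx addr0.
by rewrite raddf0 raddf0 mul0mx.
Qed.

Lemma adj_ket0_ket0 : adj ket0 *m ket0 = 1%:M.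
Proof. by rewrite ket0_block_col. Qed.

Lemma tens_ket0 (rho : 'M[C]_n) :
  tensmx (delta_mx (0 : 'I_k.+1) 0) rho = ket0 *m rho *m adj ket0.
Proof.
apply/matrixP=> i j.
case: (mxtens_indexP i) => b a; case: (mxtens_indexP j) => b' a'.
rewrite tensmxE block_col_mul block_col_mul_adj mxE.
rewrite adj_scalar mul_mx_scalar mul_scalar_mx scalerA !mxE rmorph_nat.
by rewrite -natrM mulnb andbC.
Qed.

(** Tracing out the ancilla turns the blocks of [U *m ket0] into Kraus operators, so only this block
    column of [U] matters. *)
Lemma dilatesP (Phi : 'M[C]_n -> 'M[C]_n) (U : 'M[C]_(k.+1 * n))
    (F : 'I_k.+1 -> 'M[C]_n) : U *m ket0 = block_col F ->
  dilates Phi U <-> (forall rho, density rho -> Phi rho = kraus_map F rho).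
Proof.
move=> UF; have E rho :
    ptraceB (U *m (tensmx (delta_mx (0 : 'I_k.+1) 0) rho) *m adj U) = kraus_map F rho.
  rewrite tens_ket0 !mulmxA UF.
  by rewrite -mulmxA -adjM UF ptraceB_block_col.
by split=> H rho /H; rewrite E.
Qed.

End StandardState.

(** * The superoperator trace as an invariant of the channel *)

Section SuperoperatorTrace.
Variables (R : realType) (n : nat).
Local Notation C := R[i].

Lemma density_pure (v : 'cV[C]_n) :
  (adj v *m v) 0 0 = 1 -> density (v *m adj v).
Proof.
move=> v1; split=> [w|]; last by rewrite mxtrace_mulC /mxtrace big_ord1.
have vw : adj v *m w = adj (adj w *m v) by rewrite adjM adjK.
rewrite mulmxA -mulmxA vw mxE big_ord1 adjE.
by rewrite mul_conjC_ge0.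
Qed.

Lemma kraus_mapE (d : nat) (K : 'I_d -> 'M[C]_n) (X : 'M[C]_n) i i' :
  kraus_map K X i i' = \sum_j \sum_a' (\sum_a K j i a * X a a') * (K j i' a')^*.
Proof.
rewrite summxE; apply: eq_bigr => j _; rewrite mxE; apply: eq_bigr => a' _.
by rewrite mxE adjE.
Qed.

Lemma kraus_mapD (d : nat) (K : 'I_d -> 'M[C]_n) (X Y : 'M[C]_n) :
  kraus_map K (X + Y) = kraus_map K X + kraus_map K Y.
Proof.
by rewrite -big_split; apply: eq_bigr => j _; rewrite mulmxDr mulmxDl.
Qed.

Lemma kraus_mapZ (d : nat) (K : 'I_d -> 'M[C]_n) a (X : 'M[C]_n) :
  kraus_map K (a *: X) = a *: kraus_map K X.
Proof.
by rewrite scaler_sumr; apply: eq_bigr => j _; rewrite -scalemxAr -scalemxAl.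
Qed.

(** Both maps are linear, and by polarization the pure states span all matrices. *)
Lemma kraus_map_eq_delta (d e : nat) (K : 'I_d -> 'M[C]_n) (F : 'I_e -> 'M[C]_n) :
    (forall rho, density rho -> kraus_map K rho = kraus_map F rho) ->
  forall i i', kraus_map K (delta_mx i i') = kraus_map F (delta_mx i i').
Proof.
move=> KF.
(* Agreement on unit vectors extends by homogeneity to every [v]; the zero vector is treated
   apart. *)
have pure (v : 'cV[C]_n) : kraus_map K (v *m adj v) = kraus_map F (v *m adj v).
  have /= v2 : (adj v *m v) 0 0 = \sum_i `|v i 0| ^+ 2.
    by rewrite mxE; apply: eq_bigr => i _; rewrite adjE normCKC.
  set N := (adj v *m v) 0 0 in v2.
  have N0 : 0 <= N by rewrite v2; apply: sumr_ge0 => i _; rewrite exprn_ge0.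
  have [NZ|NZ] := eqVneq N 0.
    have /eqP : (adj v) *m adj (adj v) = 0.
      by apply/matrixP=> i j; rewrite adjK !ord1 -/N NZ mxE.
    rewrite -[v]adjK => /eqP/adj_mulmx_eq0 ->.
    by rewrite mulmx0 -(scale0r 0) !kraus_mapZ !scale0r.
  have -> : v *m adj v = N *: ((sqrtC N)^-1 *: v *m adj ((sqrtC N)^-1 *: v)).
    rewrite adjZ -scalemxAl -scalemxAr !scalerA -mulrA -normCK.
    by rewrite ger0_norm ?invr_ge0 ?sqrtC_ge0// exprVn sqrtCK mulfV// scale1r.
  rewrite !kraus_mapZ; congr (_ *: _); apply/KF/density_pure.
  rewrite adjZ -scalemxAl -scalemxAr !scalerA mxE -/N mulrC mulrC -normCKC.
  by rewrite ger0_norm ?invr_ge0 ?sqrtC_ge0// exprVn sqrtCK mulVf.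
move=> i i'; pose ket (l : 'I_n) : 'cV[C]_n := delta_mx l 0.
have ee l l' : ket l *m adj (ket l') = delta_mx l l'.
  by rewrite adj_delta mul_delta_mx.
(* In the first two terms the parts in [delta_mx i' i] cancel; the surplus [(1 + 'i) / 2] on both
   diagonal units is removed by the last two. *)
have pol : delta_mx i i' = 2^-1 *: ((ket i + ket i') *m adj (ket i + ket i'))
    + ('i / 2) *: ((ket i + 'i *: ket i') *m adj (ket i + 'i *: ket i'))
    + (- (1 + 'i) / 2) *: (ket i *m adj (ket i))
    + (- (1 + 'i) / 2) *: (ket i' *m adj (ket i')).
  rewrite !raddfD /= !adjZ conjCi !(mulmxDl, mulmxDr) -!scalemxAl -!scalemxAr.
  rewrite !ee; apply/matrixP=> a b; rewrite [RHS]mxE.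
  have i2 : 'i * 'i = -1 :> C by rewrite -expr2 sqrCi.
  rewrite !mxE.
  move: 'i i2 (_ && _)%:R (_ && _)%:R (_ && _)%:R (_ && _)%:R => /= I i2 x p q w.
  (* The two sides agree only modulo [I * I + 1], so that multiple is made explicit. *)
  transitivity (w + (I * I + 1) * ((p - w - I * x) / 2)); last by field.
  by rewrite i2 addNr mul0r addr0.
by rewrite pol !kraus_mapD !kraus_mapZ !pure.
Qed.

(* The trace of the superoperator X |-> sum_j K j X (K j)^*. *)
Lemma mxtrace_kraus (d : nat) (K : 'I_d -> 'M[C]_n) :
  \sum_i \sum_i' kraus_map K (delta_mx i i') i i' = \sum_j `|\tr (K j)| ^+ 2.
Proof.
under [RHS]eq_bigr => j _ do rewrite normCK rmorph_sum mulr_suml.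
rewrite [RHS]exchange_big; apply: eq_bigr => i _ /=.
under [RHS]eq_bigr => j _ do rewrite mulr_sumr.
rewrite [RHS]exchange_big; apply: eq_bigr => i' _ /=.
rewrite kraus_mapE; apply: eq_bigr => j _.
rewrite (bigD1 i')//= (bigD1 i)//= !mxE !eqxx mulr1.
rewrite !big1 => [|a ai|a ai]; first by rewrite !addr0.
  rewrite big1 ?mul0r// => a' _; by rewrite mxE (negPf ai) andbF mulr0.
by rewrite mxE (negPf ai) mulr0.
Qed.

End SuperoperatorTrace.

(** * Eigenvalue angles, cost and compressions of a unitary *)

Section Spectrum.
Variables (R : realType).
Local Notation C := R[i].

(** The angle is [acos] of the real part, with the sign of the imaginary part. *)
Lemma unit_expiC (a : C) : a * a^* = 1 ->
  exists t : R, [/\ - pi < t, t <= pi & a = expiC t].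
Proof.
case: a => x y /eqP; rewrite eq_complex /= => /andP[/eqP xy _].
have {}xy : y ^+ 2 = 1 - x ^+ 2 by rewrite -xy; ring.
have x1 : -1 <= x <= 1.
  by have := sqr_ge0 y; rewrite xy => ?; apply/andP; split; nra.
have sy : sin (acos x) = `|y| by rewrite sin_acos// -xy sqrtr_sqr.
have cx : cos (acos x) = x by rewrite acosK// in_itv.
have [y0|y0] := leP 0 y.
  exists (acos x); split; last by rewrite /expiC cx sy ger0_norm.
    by rewrite (lt_le_trans _ (acos_ge0 x1))// oppr_lt0 pi_gt0.
  exact: acos_lepi.
exists (- acos x); split; last by rewrite /expiC cosN sinN cx sy ltr0_norm// opprK.
  rewrite ltrN2 acos_ltpi// (andP x1).2 andbT lt_neqAle (andP x1).1 andbT.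
  (* The excluded angle [- pi] would need real part -1, hence [y = 0], against [y < 0]. *)
  apply: contraTneq y0 => xN1; have /eqP : y ^+ 2 = 0 by rewrite xy -xN1; ring.
  by rewrite sqrf_eq0 => /eqP ->; rewrite ltxx.
by rewrite (le_trans _ (pi_ge0 R))// oppr_le0 acos_ge0.
Qed.

Lemma ucost_ge (N : nat) (U : 'M[C]_N) (t : R) :
  - pi < t -> t <= pi -> eigenvalue U (expiC t) -> `|t| <= ucost U.
Proof.
move=> t1 t2 Ut; apply: ub_le_sup; last by exists t => //; split; rewrite ?t1.
by exists pi => x [u [/andP[u1 u2] _] <-]; rewrite ler_norml (ltW u1).
Qed.

Lemma ucost_le (N : nat) (U : 'M[C]_N) (x : R) : 0 <= x ->
  (forall t, - pi < t -> t <= pi -> eigenvalue U (expiC t) -> `|t| <= x) ->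
  ucost U <= x.
Proof.
move=> x0 Ux; rewrite /ucost; set S := (X in sup X).
(* Without eigenvalues [sup] takes its default value 0, whence the hypothesis [0 <= x]. *)
have [->|/set0P S0] := eqVneq S set0; first by rewrite sup0.
by apply: ge_sup => // _ [t [/andP[t1 t2] Ut] <-]; apply: Ux.
Qed.

Lemma ucost_ge0 (N : nat) (U : 'M[C]_N) : 0 <= ucost U.
Proof.
rewrite /ucost; set S := (X in sup X).
have [->|/set0P[x Sx]] := eqVneq S set0; first by rewrite sup0.
apply: (@le_trans _ _ x); first by case: Sx => t _ <-.
apply: ub_le_sup => //.
by exists pi => _ [u [/andP[u1 u2] _] <-]; rewrite ler_norml (ltW u1).
Qed.

Lemma ucost_le_pi (N : nat) (U : 'M[C]_N) : ucost U <= pi.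
Proof.
by apply: ucost_le => [|t t1 t2 _]; rewrite ?pi_ge0// ler_norml (ltW t1).
Qed.

Lemma cos_norm (t : R) : cos `|t| = cos t.
Proof. by case: (ger0P t) => _ //; rewrite cosN. Qed.

(** [cos] is even, and decreasing on [[0, pi]], where the cost lies. *)
Lemma cos_ucost_le (N : nat) (U : 'M[C]_N) (a : C) :
  unitary U -> eigenvalue U a -> cos (ucost U) <= complex.Re a.
Proof.
move=> Uu Ua; have [t [t1 t2 at_]] := unit_expiC (unitary_eigenvalue_norm Uu Ua).
have tU : `|t| <= ucost U by apply: (ucost_ge t1 t2); rewrite -at_.
have tI : `|t| \in `[0, pi] by rewrite in_itv/= normr_ge0 (le_trans tU (ucost_le_pi U)).
have uI : ucost U \in `[0, pi] by rewrite in_itv/= ucost_ge0 ucost_le_pi.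
by rewrite at_ /= -(cos_norm t) leNgt ltr_cos// -leNgt.
Qed.

Lemma adj_tmx (m n : nat) (A : 'M[C]_(m, n)) : adj A = map_mx Num.conj A^T.
Proof. by rewrite /adj map_trmx. Qed.

(** With [U] diagonalised by the unitary [S], eigenvalue [l] gets as weight [w l] the squared norm
    of row [l] of [S *m A]; the weights add up to the trace of [adj A *m A], which is [n]. *)
Lemma Re_mxtrace_compression_ge (N n : nat) (U : 'M[C]_N) (A : 'M[C]_(N, n)) (m : R) :
  unitary U -> adj A *m A = 1%:M ->
  (forall a, eigenvalue U a -> m <= complex.Re a) ->
  m *+ n <= complex.Re (\tr (adj A *m U *m A)).
Proof.
move=> Uu AA mU.
have Un : U \is normalmx by apply/normalmxP; rewrite -adj_tmx adj_unitary.
have /orthomx_spectralP UE := Un.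
set S := spectralmx U in UE; set D := spectral_diag U in UE.
have Su : unitary S by rewrite /unitary adj_tmx; apply/unitarymxP/spectral_unitarymx.
have SV : invmx S = adj S.
  by rewrite adj_tmx; apply/invmx_unitary/spectral_unitarymx.
have SU : S *m U = diag_mx D *m S.
  by rewrite UE !mulmxA SV Su mul1mx.
have DU l : eigenvalue U (D 0 l).
  apply/eigenvalueP; exists (row l S).
    by rewrite -row_mul SU row_mul row_diag_mx -scalemxAl -rowE.
  apply/negP => /eqP Sl0; have := congr1 (fun M : 'M[C]_N => M l l) Su.
  rewrite mulmx_adj_diag mxE eqxx big1 => [/eqP|j _]; first by rewrite eq_sym oner_eq0.
  by have /rowP/(_ j) := Sl0; rewrite !mxE => ->; rewrite normr0 expr0n.
pose w l := complex.Re (\sum_a `|(S *m A) l a| ^+ 2).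
have wE l : (w l)%:C%C = (S *m A *m adj (S *m A)) l l.
  rewrite RRe_real ?mulmx_adj_diag//; apply: ger0_real.
  by apply: sumr_ge0 => a _; rewrite exprn_ge0.
have w0 l : 0 <= w l.
  by rewrite -lecR wE mulmx_adj_diag; apply: sumr_ge0 => a _; rewrite exprn_ge0.
have trE : \tr (adj A *m U *m A) = \sum_l D 0 l * (w l)%:C%C.
  transitivity (\tr (adj (S *m A) *m (diag_mx D *m (S *m A)))).
    rewrite adjM !mulmxA -(mulmxA _ (diag_mx D) S) -SU !mulmxA.
    by rewrite -(mulmxA _ (adj S) S) (adj_unitary Su) mulmx1.
  rewrite mxtrace_mulC -mulmxA; apply: eq_bigr => l _.
  by rewrite mul_diag_mx mxE wE.
have wn : \sum_l w l = n%:R.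
  apply: complexI; rewrite rmorph_sum /=; under eq_bigr do rewrite wE.
  rewrite -[LHS]/(\tr _) mxtrace_mulC adjM -mulmxA (mulmxA _ S) (adj_unitary Su).
  by rewrite mul1mx AA mxtrace1 rmorph_nat.
rewrite trE -[m *+ n]mulr_natr -wn mulr_sumr (raddf_sum (@complex.Re R)) /=.
apply: ler_sum => l _; case: (D 0 l) (mU _ (DU l)) => x y /= mx.
by rewrite mulr0 subr0 ler_wpM2r.
Qed.

End Spectrum.

(** * Lower bound on the cost of a dilation *)

Section LowerBound.
Variables (R : realType).
Local Notation C := R[i].

(** In a full-rank factorization [P = B *m D], idempotence cancels to [D *m B = 1%:M], and the trace
    is cyclic. *)
Lemma mxtrace_projector (n : nat) (P : 'M[C]_n) :
  P *m P = P -> \tr P = (\rank P)%:R.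
Proof.
move=> PP; set B := col_base P; set D := row_base P.
have BD : B *m D = P by exact: mulmx_base.
have Bfull : row_full B by exact: col_base_full.
have Dfree : row_free D by exact: row_base_free.
clearbody B D; have DB : D *m B = 1%:M.
  apply: (row_free_inj Dfree); rewrite mul1mx; apply: (row_full_inj Bfull).
  by rewrite !mulmxA BD -mulmxA BD PP.
by rewrite -[in LHS]BD mxtrace_mulC DB mxtrace1.
Qed.

(** Here [x] is the superoperator trace, of which the squared modulus of [\tr (F 0)] is one
    nonnegative summand. *)
Lemma cos_ucost_dilation_le (k n d : nat) (K : 'I_d -> 'M[C]_n)
    (U : 'M[C]_(k.+1 * n)) (x : R) :
  (0 < n)%N -> unitary U -> dilates (kraus_map K) U ->
  \sum_j `|\tr (K j)| ^+ 2 = x%:C%C ->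
  cos (ucost U) <= Num.sqrt (x / n%:R ^+ 2).
Proof.
move=> n0 Uu UK Kx; pose A := ket0 R k n.
have [F UF] : exists F, U *m A = block_col F by eexists; exact: block_col_surj.
have {}UK := (dilatesP _ UF).1 UK.
have trF0 : complex.Re (\tr (F 0)) ^+ 2 <= x.
  rewrite -lecR -Kx -mxtrace_kraus.
  under eq_bigr do under eq_bigr do rewrite (kraus_map_eq_delta UK).
  rewrite mxtrace_kraus (bigD1 0)//=.
  rewrite (@le_trans _ _ (`|\tr (F 0)| ^+ 2))//.
    by rewrite -add_Re2_Im2 lecR lerDl sqr_ge0.
  by rewrite lerDl; apply: sumr_ge0 => b _; rewrite exprn_ge0.
have := Re_mxtrace_compression_ge Uu (adj_ket0_ket0 R k n)
  (fun a => @cos_ucost_le _ _ U a Uu).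
rewrite -mulmxA UF ket0_block_col -[cos _ *+ n]mulr_natr.
rewrite -ler_pdivlMr ?ltr0n// => /le_trans; apply.
rewrite (le_trans (ler_norm _))// -sqrtr_sqr ler_wsqrtr//.
by rewrite exprMn exprVn ler_wpM2r// invr_ge0 exprn_ge0.
Qed.

End LowerBound.

(** * Cheap unitary extension of an isometry *)

Section Optimal.
Variables (R : realType) (N n : nat) (c : R) (A V : 'M[R[i]]_(N, n)).
Hypotheses (c0 : 0 <= c) (c1 : c <= 1).
Hypotheses (AA : adj A *m A = 1%:M) (VV : adj V *m V = 1%:M).
Hypothesis AV : adj A *m V = c%:C%C%:M.

(** [W] is the component of [V] orthogonal to the range of [A], so the rotation sends [A] to
    [c A + W = V]. *)
Lemma isometry_extension : exists U : 'M[R[i]]_N,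
  [/\ unitary U, U *m A = V & ucost U <= acos c].
Proof.
pose W := V - c%:C%C *: A; exists (plane_rotation c%:C%C A W).
have creal : (c%:C%C)^* = c%:C%C by exact: conjc_real.
have c10 : 1 + c%:C%C != 0 :> R[i].
  by rewrite -(rmorph1 (real_complex R)) -rmorphD fmorph_eq0 gt_eqF// ltr_wpDr.
have AW : adj A *m W = 0.
  by rewrite mulmxBr AV -scalemxAr AA scalemx1 subrr.
have WW : adj W *m W = (1 - c%:C%C ^+ 2)%:M.
  rewrite {2}/W mulmxBr -scalemxAr.
  rewrite (_ : adj W *m A = 0); last by rewrite -[A]adjK -adjM AW raddf0.
  rewrite scaler0 subr0 raddfB/= mulmxBl adjZ -scalemxAl VV AV creal.
  by rewrite scale_scalar_mx -raddfB.
split; first exact: plane_rotation_unitary.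
  by rewrite plane_rotation_first// addrC subrK.
have cI : -1 <= c <= 1 by rewrite c1 (le_trans _ c0)// oppr_le0.
apply: ucost_le => [|t t1 t2 /plane_rotation_eigenvalue Ut].
  by rewrite acos_ge0.
have tK : `|t| = acos (cos t).
  by rewrite -cos_norm cosK// in_itv/= normr_ge0 ler_norml (ltW t1).
(* The real part [cos t] is 1 or [c], so [|t|] is 0 or [acos c]. *)
have /eqP := Ut creal c10 AA AW WW.
rewrite -complexRe /= mulf_eq0 !subr_eq0 => /orP[] /eqP.
  by move=> [ct]; rewrite tK ct acos1 acos_ge0.
by move=> [ct]; rewrite tK -ct.
Qed.

End Optimal.

(** * Optimal Kraus operators of the projector channel *)

Section ProjectorChannel.
Variables (R : realType) (n d : nat).
Local Notation C := R[i].
Variables (s : 'I_d -> C) (P : 'I_d -> 'M[C]_n) (c : R).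
Hypotheses (PP : forall j, P j *m P j = P j) (Padj : forall j, adj (P j) = P j).
Hypothesis sP : \sum_j `|s j| ^+ 2 *: P j = 1%:M.
Hypothesis cs : c%:C%C ^+ 2 * \sum_j `|s j| ^+ 2 = 1.

Let q : C := c%:C%C ^+ 2.

(* Mixing the operators s_j P_j with the unit vector c (s_j)^* gives the
   multiple c of the identity; the remaining operators are s_j P_j - s_j c^2,
   so the mixing matrix is that unit row on top of the projector onto its
   orthogonal complement. *)
Definition mixed_kraus (b : 'I_d.+1) : 'M[C]_n :=
  if unlift 0 b is Some j then s j *: (P j - q%:M) else (c%:C%C)%:M.

Let conj_c : (c%:C%C)^* = c%:C%C :> C.
Proof. exact: conjc_real. Qed.

Let conj_q : q^* = q.
Proof. by rewrite rmorphXn /= conj_c. Qed.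

Let adj_PB j : adj (P j - q%:M) = P j - q%:M.
Proof. by rewrite adj_is_additive Padj adj_scalar conj_q. Qed.

Let sqq : (\sum_j `|s j| ^+ 2) * (q * q) = q.
Proof. by rewrite mulrA (mulrC (\sum_j _) q) cs mul1r. Qed.

(** The scalar operator contributes [q], the others [(1 - 2 q) + q] by [sP] and [sqq]. *)
Lemma mixed_kraus_isometry : \sum_b adj (mixed_kraus b) *m mixed_kraus b = 1%:M.
Proof.
rewrite big_ord_recl {1 2}/mixed_kraus unlift_none adj_scalar conj_c -scalar_mxM.
under eq_bigr => j _.
  rewrite /mixed_kraus liftK adjZ -scalemxAl -scalemxAr scalerA -normCKC.
  rewrite adj_PB mulmxBl !mulmxBr PP.
  rewrite mul_scalar_mx mul_mx_scalar -scalar_mxM.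
  rewrite (_ : _ *: _ = (1 - q *+ 2) *: (`|s j| ^+ 2 *: P j)
     + `|s j| ^+ 2 *: (q * q)%:M); last first.
    by apply/matrixP=> a a'; rewrite !mxE; ring.
  over.
rewrite big_split /= -scaler_sumr -scaler_suml sP scale_scalar_mx sqq.
rewrite -expr2 -/q scalemx1 -!raddfD /=; congr _%:M; ring.
Qed.

Lemma kraus_map_mixed (rho : 'M[C]_n) :
  kraus_map mixed_kraus rho = kraus_map (fun j => s j *: P j) rho.
Proof.
rewrite /kraus_map big_ord_recl {1 2}/mixed_kraus unlift_none adj_scalar conj_c.
rewrite mul_mx_scalar mul_scalar_mx scalerA -expr2 -/q.
(* By [sP] each cross term sums to [- q *: rho]; the scalar operator and the last term each give
   [q *: rho], which balances them. *)
transitivity (q *: rho + \sum_j (s j *: P j *m rho *m adj (s j *: P j)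
  - q *: ((`|s j| ^+ 2 *: P j) *m rho) - q *: (rho *m (`|s j| ^+ 2 *: P j))
  + `|s j| ^+ 2 *: (q ^+ 2 *: rho))).
  congr (_ + _); apply: eq_bigr => j _; rewrite /mixed_kraus liftK !adjZ adj_PB Padj.
  rewrite -!(scalemxAl, scalemxAr) !scalerA -normCK.
  rewrite mulmxBl !mulmxBr !mulmxBl mul_scalar_mx !mul_mx_scalar -scalemxAl.
  move: (P j *m rho *m P j) (P j *m rho) (rho *m P j) => x y z.
  by apply/matrixP=> a a'; rewrite !mxE; ring.
rewrite big_split /= -scaler_suml !big_split /= !sumrN -!scaler_sumr.
rewrite -mulmx_suml -mulmx_sumr sP mul1mx mulmx1 scalerA expr2 sqq.
by apply/matrixP=> a a'; rewrite !mxE; ring.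
Qed.

Lemma projector_channel_dilation : 0 <= c -> c <= 1 ->
  exists U : 'M[C]_(d.+1 * n), [/\ unitary U,
    dilates (kraus_map (fun j => s j *: P j)) U & ucost U <= acos c].
Proof.
move=> c0 c1.
have [U [Uu UA Uc]] : exists U : 'M[C]_(d.+1 * n), [/\ unitary U,
    U *m ket0 R d n = block_col mixed_kraus & ucost U <= acos c].
  apply: isometry_extension => //; first exact: adj_ket0_ket0.
    by rewrite adj_block_col_mul mixed_kraus_isometry.
  by rewrite ket0_block_col /mixed_kraus unlift_none.
exists U; split=> //; apply/(dilatesP _ UA) => rho _.
by rewrite kraus_map_mixed.
Qed.

End ProjectorChannel.

(** * The channel cost from the two bounds *)

Theorem theorem4 (R : realType) (n d r : nat) (s : 'I_d -> R[i]) (P : 'I_d -> 'M[R[i]]_n) :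
  (0 < n)%N ->
  (forall j, P j *m P j = P j /\ adj (P j) = P j /\ \rank (P j) = r) ->
  \sum_(j < d) adj (s j *: P j) *m (s j *: P j) = 1%:M ->
  ccost (kraus_map (fun j => s j *: P j)) = acos (Num.sqrt (r%:R / n%:R : R)).
Proof.
move=> n0 HP HK.
have PP j := (HP j).1; have Padj j := (HP j).2.1; have Pr j := (HP j).2.2.
have sP : \sum_j `|s j| ^+ 2 *: P j = 1%:M.
  rewrite -HK; apply: eq_bigr => j _.
  by rewrite adjZ Padj -scalemxAl -scalemxAr scalerA -normCKC PP.
(* Traces are taken in [sP], each projector having trace [r]. *)
have sr : (\sum_j `|s j| ^+ 2) * r%:R = n%:R.
  have := congr1 mxtrace sP; rewrite mxtrace1 raddf_sum /= => <-.
  rewrite mulr_suml; apply: eq_bigr => j _.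
  by rewrite mxtraceZ mxtrace_projector// Pr.
have nR : 0 < n%:R :> R by rewrite ltr0n.
have rn : (r <= n)%N.
  have [j _|dE] := pickP 'I_d; first by rewrite -(Pr j) rank_leq_row.
  (* Without Kraus operators the trace identity would read [0 = n]. *)
  by move/eqP: sr; rewrite big_pred0// mul0r eq_sym pnatr_eq0 -leqn0 leqNgt n0.
set c := Num.sqrt (r%:R / n%:R : R).
have c2 : c ^+ 2 = r%:R / n%:R by rewrite sqr_sqrtr// divr_ge0.
have c0 : 0 <= c by exact: sqrtr_ge0.
have c1 : c <= 1.
  by rewrite -(sqrtr1 R) ler_wsqrtr// ler_pdivrMr// mul1r ler_nat.
have cI : -1 <= c <= 1 by rewrite c1 (le_trans _ c0)// oppr_le0.
have cs : c%:C%C ^+ 2 * \sum_j `|s j| ^+ 2 = 1.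
  rewrite -rmorphXn c2 /= fmorph_div !rmorph_nat mulrAC.
  by rewrite (mulrC r%:R) sr mulfV// pnatr_eq0 -lt0n.
have Ktr : \sum_j `|\tr (s j *: P j)| ^+ 2 = (r%:R * n%:R : R)%:C%C.
  rewrite rmorphM /= !rmorph_nat -sr mulr_suml mulr_sumr.
  apply: eq_bigr => j _; rewrite mxtraceZ mxtrace_projector// Pr.
  by rewrite normrM normr_nat; ring.
have lower k (U : 'M[R[i]]_(k.+1 * n)) : unitary U ->
    dilates (kraus_map (fun j => s j *: P j)) U -> acos c <= ucost U.
  move=> Uu UK; have := cos_ucost_dilation_le n0 Uu UK Ktr.
  have -> : Num.sqrt (r%:R * n%:R / n%:R ^+ 2) = c.
    by rewrite /c; congr Num.sqrt; field; rewrite gt_eqF.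
  (* A cost below [acos c] would have cosine above [c], as [cos] decreases on [[0, pi]]. *)
  rewrite leNgt => cU; rewrite leNgt; apply: contra cU => ac.
  have acI : acos c \in `[0, pi] by rewrite in_itv/= acos_ge0// acos_lepi.
  have ucI : ucost U \in `[0, pi] by rewrite in_itv/= ucost_ge0 ucost_le_pi.
  have cK : cos (acos c) = c by rewrite acosK// in_itv.
  by rewrite -cK ltr_cos.
have [U [Uu UK Uc]] := projector_channel_dilation PP Padj sP cs c0 c1.
have UcE : ucost U = acos c by apply/le_anti; rewrite Uc lower.
(* The infimum is attained at the rotation [U]. *)
apply/le_anti/andP; split.
  rewrite -UcE; apply: ge_inf; last by exists d, U.
  by exists (acos c) => _ [k [V [Vu [VK ->]]]]; apply: lower.
apply: lb_le_inf; first by exists (ucost U), d, U.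
by move=> _ [k [V [Vu [VK ->]]]]; apply: lower.
Qed.
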